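(* Let $k,\kappa,m$ be positive integers with $k,\kappa\geqslant2$ and $\kappa\leqslant k^m$, and let $\varepsilon,\sigma,\eta>0$ satisfy \[ \varepsilon\leqslant1-\frac{1}{2\kappa},\qquad \sigma\leqslant\frac{\varepsilon^{\kappa-1}}{2\kappa},\qquad \eta\leqslant\frac{\sigma}{4^{\kappa-1}}. \] Let $A$ be a set with $|A|=k$, let $n>m$ be an integer, and let $\langle D_t:t\in A^n\rangle$ be an $\eta$-stationary stochastic process in a probability space $(\Omega,\mathcal{F},\mathbb{P})$ such that $|\mathbb{P}(D_t)-\varepsilon|\leqslant\eta$ for every $t\in A^n$. Then either \begin{enumerate} \item[(i)] for every nonempty $1$-separated set $G\subseteq A^n$ with $|G|\leqslant\kappa$ and whose type $\tau(G)$ has dimension at most $m$, we have $\big|\mathbb{P}\big(\bigcap_{t\in G}D_t\big)-\varepsilon^{|G|}\big|\leqslant\sigma$; or \item[(ii)] there exist a combinatorial subspace $V$ of $A^n$ with $\dim(V)\geqslant n-m$, a nonempty subset $\Gamma$ of $A$, an element $\beta\in A\setminus\Gamma$, and a stochastic process $\langle S_t:t\in V\rangle$ in $(\Omega,\mathcal{F},\mathbb{P})$ such that (a) for every $t\in V$, $S_t=\bigcap_{\alpha\in\Gamma}E^\alpha_t$ where for every $\alpha\in\Gamma$ the process $\langle E^\alpha_t:t\in V\rangle$ is $(\alpha,\beta)$-insensitive in $V$; and (b) for every $t\in V$, \[ \mathbb{P}(S_t)\geqslant\frac{\varepsilon^{\kappa-1}}{4\kappa}\quad\text{and}\quad\mathbb{P}(D_t\,|\,S_t)\geqslant\varepsilon+\frac{\sigma}{4^{\kappa-1}}.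 \] \end{enumerate}
   Context: $A^n$ denotes sequences of length $n$ in $A$; $t(i)$ is the $i$-th coordinate of $t$. For variables $x_1,\dots,x_d\notin A$, a $d$-variable word over $A$ of length $n$ is a sequence $v$ of length $n$ in $A\cup\{x_1,\dots,x_d\}$ in which each $x_i$ appears and, for $i<j$, all appearances of $x_i$ precede all appearances of $x_j$; $v(\alpha_1,\dots,\alpha_d)$ replaces each $x_i$ by $\alpha_i$. A combinatorial space is $V=\{v(\alpha_1,\dots,\alpha_d):\alpha_i\in A\}$, of dimension $d$, with canonical isomorphism $\mathrm{I}_V\colon A^d\to V$, $(\alpha_1,\dots,\alpha_d)\mapsto v(\alpha_1,\dots,\alpha_d)$; a combinatorial subspace of $A^n$ is a combinatorial space contained in $A^n$. Type: for $G\subseteq A^n$ with $|G|=p\geqslant2$, enumerate it as $(t_1,\dots,t_p)$, let $R$ be the $n\times p$ matrix with $(i,j)$ entry $t_j(i)$, delete all rows whose entries are all equal, then replace each maximal block of consecutive identical rows by one copy, obtaining an $m'\times p$ matrix with columns $s_1,\dots,s_p\in A^{m'}$; $\tau(G)=\{s_1,\dots,s_p\}$ (independent of enumeration), of dimension $m'$. If $|G|=1$, $\tau(G)=\emptyset$. A process $\langle D_t:t\in A^n\rangle$ is $\eta$-stationary if for all nonempty $G_1,G_2\subseteq A^n$ with $\tau(G_1)=\tau(G_2)$, $\big|\mathbb{P}\big(\bigcap_{t\in G_1}D_t\big)-\mathbb{P}\big(\bigcap_{t\in G_2}D_t\big)\big|\leqslant\eta$. A tuple $(t_1,\dots,t_p)$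 of distinct elements of $A^n$ is $1$-separated if for every $j\geqslant2$ there is $i\in[n]$ with $t_j(i)\neq t_q(i)$ for all $q<j$; a nonempty set $G\subseteq A^n$ is $1$-separated if some enumeration of it is a $1$-separated tuple. For $\alpha\neq\beta$, $s,t\in A^d$ are $(\alpha,\beta)$-equivalent if for every coordinate $i$ and every $\gamma\in A\setminus\{\alpha,\beta\}$, $s(i)=\gamma$ iff $t(i)=\gamma$. A process $\langle E_t:t\in V\rangle$ indexed by a $d$-dimensional combinatorial space $V$ is $(\alpha,\beta)$-insensitive in $V$ if $E_{\mathrm{I}_V(s)}=E_{\mathrm{I}_V(t)}$ for all $(\alpha,\beta)$-equivalent $s,t\in A^d$. *)

(* Defs.v *)
From mathcomp Require Import all_boot all_order all_algebra.
From mathcomp Require Import all_classical all_reals all_analysis.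

Set Implicit Arguments.
Unset Strict Implicit.
Unset Printing Implicit Defensive.

Import Order.TTheory GRing.Theory Num.Theory.

Local Open Scope classical_set_scope.
Local Open Scope ring_scope.

(* In a word over [A] with variables [x_0, ..., x_(d-1)], [inl a] is the letter
   [a] and [inr j] is the variable [x_j]. *)
Definition is_variable_word (A : finType) (d n : nat)
    (v : n.-tuple (A + 'I_d)) : Prop :=
  (forall j : 'I_d, inr j \in v) /\
  (forall (j1 j2 : 'I_d) (p q : 'I_n), (j1 < j2)%N ->
     tnth v p = inr j1 -> tnth v q = inr j2 -> (p < q)%N).

Definition word_subst (A : finType) (d n : nat) (v : n.-tuple (A + 'I_d))
    (a : d.-tuple A) : n.-tuple A :=
  [tuple match tnth v i with inl x => x | inr j => tnth a j end | i < n].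

(* A combinatorial subspace of [A^n] is presented by its generating word; when
   [A] has at least two elements, the word is determined by the underlying set
   [cs_set V]. *)
Record comb_subspace (A : finType) (n : nat) := CombSubspace {
  cs_dim : nat;
  cs_word : n.-tuple (A + 'I_cs_dim);
  cs_wordP : is_variable_word cs_word
}.

Definition canon_iso (A : finType) (n : nat) (V : comb_subspace A n) :
    (cs_dim V).-tuple A -> n.-tuple A :=
  word_subst (cs_word V).
Arguments canon_iso {A n} V a.

Definition cs_set (A : finType) (n : nat) (V : comb_subspace A n) :
    {set n.-tuple A} :=
  [set canon_iso V a | a : (cs_dim V).-tuple A]%SET.

Section Type_of_set.
Variables (A : finType) (n : nat).
Implicit Type G : {set n.-tuple A}.

Definition type_row G (i : 'I_n) : #|G|.-tuple A :=
  [tuple tnth (enum_val j) i | j < #|G|].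

(* Replaces each maximal block of consecutive equal items by one copy. *)
Fixpoint destutter (T : eqType) (s : seq T) : seq T :=
  if s is x :: s' then
    if ohead s' == Some x then destutter s' else x :: destutter s'
  else [::].

Definition type_rows G : seq (#|G|.-tuple A) :=
  destutter [seq r : #|G|.-tuple A <- [seq type_row G i | i <- enum 'I_n] |
              ~~ constant r].

(* Types of different dimensions have to be comparable, so the columns are
   taken in [seq A] rather than in a power of [A] with a fixed exponent. *)
Definition type_of G : set (seq A) :=
  if (1 < #|G|)%N then
    range (fun j : 'I_#|G| => [seq tnth r j | r <- type_rows G])
  else set0.

(* This is [0] when [G] is a singleton, since all rows are then constant. *)
Definition type_dim G : nat := size (type_rows G).

Definition one_separated_tuple (p : nat) (t : p.-tuple (n.-tuple A)) : Prop :=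
  uniq t /\
  (forall j : 'I_p, (0 < j)%N -> exists i : 'I_n, forall q : 'I_p, (q < j)%N ->
     tnth (tnth t j) i != tnth (tnth t q) i).

Definition one_separated G : Prop :=
  exists t : #|G|.-tuple (n.-tuple A), t =i G /\ one_separated_tuple t.

End Type_of_set.

Definition ab_equivalent (A : finType) (d : nat) (alpha beta : A)
    (s t : d.-tuple A) : Prop :=
  forall (i : 'I_d) (gamma : A), gamma != alpha -> gamma != beta ->
    (tnth s i = gamma <-> tnth t i = gamma).

Section Processes.
Context {disp : measure_display} {Omega : measurableType disp} {R : realType}.
Variables (P : probability Omega R) (A : finType) (n : nat).

(* A process indexed by a subset [I] of [A^n] is given by a function on all of
   [A^n]; its values outside [I] are irrelevant. *)
Definition is_process (I : {set n.-tuple A})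
    (D : n.-tuple A -> set Omega) : Prop :=
  forall t, t \in I -> measurable (D t).

Definition inter_event (D : n.-tuple A -> set Omega)
    (G : {set n.-tuple A}) : set Omega :=
  \bigcap_(t in [set` G]) D t.

Definition stationary (eta : R) (D : n.-tuple A -> set Omega) : Prop :=
  forall G1 G2 : {set n.-tuple A}, G1 != finset.set0 -> G2 != finset.set0 ->
    type_of G1 = type_of G2 ->
    (`|P (inter_event D G1) - P (inter_event D G2)| <= eta%:E)%E.

Definition insensitive (alpha beta : A) (V : comb_subspace A n)
    (E : n.-tuple A -> set Omega) : Prop :=
  forall s t : (cs_dim V).-tuple A, ab_equivalent alpha beta s t ->
    E (canon_iso V s) = E (canon_iso V t).

Definition cond_prob (X Y : set Omega) : \bar R :=
  (P (X `&` Y) / P Y)%E.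

End Processes.

(* Main.v *)
Require Import Defs.
From mathcomp Require Import all_boot all_order all_algebra.
From mathcomp Require Import all_classical all_reals all_analysis.
From mathcomp Require Import lra ring zify.

(* If (i) fails, take a [1]-separated set [G] of least size [l] such that
   [P (inter_event D G)] is at distance more than [sigma / 4 ^+ (kappa - l)]
   from [eps ^+ l].  The last element [x0] of [G] has a coordinate [i] whose
   letter [beta] occurs in no other element of [G] at [i].  Blowing up the row
   [i] of the type of [G] yields, for each [z] in [A^(n - dim)], a copy
   [phi z G] of [G] of the same type in which [phi z x0] runs over a
   combinatorial subspace, while [phi z x], for [x] in [G] other than [x0],
   depends only on the result of replacing [beta] by [x i] in [z].
   By stationarity and minimality, [D (phi z x0)] is positively correlated with
   the intersection of the other [D (phi z x)] if the deviation of [G] is an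
   excess; if it is a deficit, the same holds once the event of the
   second-to-last element is complemented. *)

Import Order.TTheory GRing.Theory Num.Theory.

(** * Collapsing blocks of consecutive equal items *)

Section Destutter.
Local Set Implicit Arguments.
Local Unset Strict Implicit.
Variable T : eqType.
Implicit Types (s u : seq T) (x y : T).

Lemma destutter_cons x s :
  destutter (x :: s) =
  if ohead s == Some x then destutter s else x :: destutter s.
Proof. by []. Qed.

Lemma destutter_cons2 x y s :
  destutter (x :: y :: s) =
  if y == x then destutter (y :: s) else x :: destutter (y :: s).
Proof. by []. Qed.

Lemma mem_destutter s : destutter s =i s.
Proof.
elim: s => [|x [|y s] IHs] // z; rewrite destutter_cons2.
case: eqP => [yx|_]; last by rewrite !inE IHs inE.
by rewrite IHs yx !inE orbA orbb.
Qed.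

Lemma ohead_destutter s : ohead (destutter s) = ohead s.
Proof.
elim: s => [|x [|y s] IHs] //; rewrite destutter_cons2.
by case: eqP => [<-|].
Qed.

Lemma destutter_id s : destutter (destutter s) = destutter s.
Proof.
elim: s => [|x [|y s] IHs] //; rewrite destutter_cons2.
case: ifP => // yx; rewrite destutter_cons ohead_destutter IHs.
by rewrite (inj_eq Some_inj) yx.
Qed.

(** This is why blowing up a row of a matrix into several consecutive copies leaves the type
    unchanged. *)
Lemma destutter_nseq s x k u :
  destutter (s ++ x :: nseq k x ++ u) = destutter (s ++ x :: u).
Proof.
elim: s => [|y s IHs].
  by rewrite !cat0s; elim: k => // k IHk; rewrite destutter_cons2 eqxx.
by rewrite !cat_cons !destutter_cons IHs; case: s {IHs}.
Qed.

Lemma size_destutter_cons2 x y s :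
  size (destutter (x :: y :: s)) = (y != x) + size (destutter (y :: s)).
Proof. by rewrite destutter_cons2; case: eqP. Qed.

(** The size counts the maximal blocks, and deleting items can only remove or merge blocks. *)
Lemma size_destutter_subseq s u :
  subseq s u -> size (destutter s) <= size (destutter u).
Proof.
have gt0 x v : 0 < size (destutter (x :: v)).
  by elim: v x => // y v IHv x; rewrite size_destutter_cons2 ltn_addl.
(* A common head [x] is kept in front of both sequences, so that the induction records whether the
   next item opens a new block. *)
suff le_cons x v w : subseq v w ->
    size (destutter (x :: v)) <= size (destutter (x :: w)).
  elim: u s => [|y u IHu] [|x s] //=; case: (x =P y) => [->|_] su.
    exact: le_cons.
  apply: leq_trans (IHu _ su) _; case: (u) => // z v.
  by rewrite size_destutter_cons2 leq_addl.
elim: w x v => [|y w IHw] x [|z v] //.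
rewrite !size_destutter_cons2 [subseq _ _]/=.
case: (z =P y) => [-> vw|/eqP zy /(IHw y)]; first by rewrite leq_add2l IHw.
rewrite size_destutter_cons2 zy.
move=> le; have [<-|_] := eqVneq y x; first by rewrite zy.
by apply: leq_trans (leq_trans le (leq_addl _ _)); rewrite leq_add2r leq_b1.
Qed.

End Destutter.

Section DestutterMap.
Local Set Implicit Arguments.
Local Unset Strict Implicit.
Variables (T T' : eqType) (f : T -> T').
Implicit Type s : seq T.

Lemma destutter_map s : injective f -> destutter (map f s) = map f (destutter s).
Proof.
move=> f_inj; elim: s => [|x [|y s] IHs] //.
rewrite [map f _]/= !destutter_cons2 (inj_eq f_inj) -/(map f (y :: s)) IHs.
by case: ifP.
Qed.

Lemma size_destutter_map s : size (destutter (map f s)) <= size (destutter s).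
Proof.
elim: s => [|x [|y s] IHs] //.
rewrite [map f _]/= !size_destutter_cons2 leq_add //.
by case: (y =P x) => [->|]; rewrite ?eqxx ?leq_b1.
Qed.

End DestutterMap.

(** * Types computed from arbitrary enumerations *)

Section Types.
Local Set Implicit Arguments.
Local Unset Strict Implicit.

Lemma constant_tupleP (T : eqType) (p : nat) (r : p.-tuple T) :
  reflect (forall j j', tnth r j = tnth r j') (constant r).
Proof.
apply: (iffP idP) => [r_const j j'|].
  case/(constantP (tnth r j)): r_const => x rE.
  by rewrite !(tnth_nth x) rE !nth_nseq size_tuple !ltn_ord.
case: p r => [|p] r r_const; first by rewrite tuple0.
apply: (@all_pred1_constant _ (tnth r ord0)).
by apply/all_tnthP => j; apply/eqP.
Qed.

(** [f] need not be bijective: the same operation permutes the columns of a matrix or selects some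
    of them. *)
Definition reindex (T : Type) (p q : nat) (f : 'I_q -> 'I_p) (r : p.-tuple T) :
    q.-tuple T := [tuple tnth r (f j) | j < q].

Variables (A : finType) (n : nat).
Implicit Types (G : {set n.-tuple A}).

Definition tuple_row p (t : p.-tuple (n.-tuple A)) (i : 'I_n) : p.-tuple A :=
  [tuple tnth (tnth t j) i | j < p].

Definition tuple_rows p (t : p.-tuple (n.-tuple A)) : seq (p.-tuple A) :=
  destutter [seq r : p.-tuple A <- [seq tuple_row t i | i <- enum 'I_n] |
              ~~ constant r].

Lemma type_row_reindex G p (t : p.-tuple (n.-tuple A)) (f : 'I_#|G| -> 'I_p) :
  (forall j, enum_val j = tnth t (f j)) ->
  type_row G =1 reindex f \o tuple_row t.
Proof.
by move=> fE i; apply: eq_from_tnth => j; rewrite !tnth_mktuple fE.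
Qed.

Lemma constant_reindex (p q : nat) (f : 'I_q -> 'I_p) (r : p.-tuple A) :
  constant r -> constant (reindex f r).
Proof.
move/constant_tupleP => r_const; apply/constant_tupleP => j j'.
by rewrite !tnth_mktuple.
Qed.

Lemma enum_val_tuple G p (t : p.-tuple (n.-tuple A)) : {subset G <= t} ->
  exists f : 'I_#|G| -> 'I_p, forall j, enum_val j = tnth t (f j).
Proof.
move=> Gt; suff: forall j : 'I_#|G|, exists i, enum_val j = tnth t i.
  exact: fin_all_exists.
by move=> j; apply/tnthP/Gt/enum_valP.
Qed.

(** The matrix of [G] is a selection of columns of the matrix of [t]. Dropping columns may turn rows
    constant or make neighbouring rows equal, but creates no new block. *)
Lemma type_dim_le G p (t : p.-tuple (n.-tuple A)) :
  {subset G <= t} -> (type_dim G <= size (tuple_rows t))%N.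
Proof.
move=> /enum_val_tuple [f fE]; rewrite /type_dim /type_rows /tuple_rows.
rewrite (eq_map (type_row_reindex fE)) map_comp filter_map.
apply: leq_trans (size_destutter_map _ _) _.
(* A row constant before the selection stays constant after it, so the rows kept for [G] form a
   subsequence of those kept for [t]. *)
apply: size_destutter_subseq; elim: (map _ _) => //= r s IHs.
case: (boolP (constant r)) => [/(constant_reindex f) -> //|_] /=.
case: ifP => _; first by rewrite eqxx.
exact: subseq_trans IHs (subseq_cons _ _).
Qed.

(** Independence of the type from the enumeration: another enumeration permutes the columns. This
    acts injectively on rows and preserves constancy, so it commutes with both reductions. *)
Lemma type_of_tuple G p (t : p.-tuple (n.-tuple A)) :
    uniq t -> t =i G -> (1 < p)%N ->
  type_of G = range (fun j : 'I_p => [seq tnth r j | r <- tuple_rows t]).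
Proof.
move=> t_uniq tG p_gt1.
have Gp : #|G| = p by rewrite -(eq_card tG) (card_uniqP t_uniq) size_tuple.
have /enum_val_tuple [f fE] : {subset G <= t} by move=> x; rewrite tG.
have f_inj : injective f.
  by move=> j j' fjj'; apply: enum_val_inj; rewrite !fE fjj'.
have [|g fK gK] := inj_card_bij f_inj; first by rewrite !card_ord Gp.
have rK : cancel (@reindex A _ _ f) (reindex g).
  by move=> r; apply: eq_from_tnth => j; rewrite !tnth_mktuple gK.
have rowsE : type_rows G = map (reindex f) (tuple_rows t).
  rewrite /type_rows /tuple_rows (eq_map (type_row_reindex fE)) map_comp.
  rewrite filter_map destutter_map; last exact: can_inj rK.
  congr (map _ (destutter _)); apply: eq_filter => r /=; congr (~~ _).
  apply/idP/idP => [r_const|]; last exact: constant_reindex.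
  by rewrite -[r]rK constant_reindex.
rewrite /type_of {1}Gp p_gt1 rowsE; apply/seteqP; split => _ [j _ <-].
  exists (f j) => //; rewrite -map_comp; apply: eq_map => r /=.
  by rewrite tnth_mktuple.
exists (g j) => //; rewrite -map_comp; apply: eq_map => r /=.
by rewrite tnth_mktuple gK.
Qed.

End Types.

(** * An inductive form of 1-separation *)

Section OneSeparated.
Local Set Implicit Arguments.
Local Unset Strict Implicit.
Variables (A : finType) (n : nat).
Implicit Types (G : {set n.-tuple A}).

Inductive sep_set : {set n.-tuple A} -> Prop :=
| SepSet0 : sep_set finset.set0
| SepSetU x (G : {set n.-tuple A}) (i : 'I_n) : sep_set G ->
    (forall y, y \in G -> tnth y i != tnth x i) -> sep_set (x |: G)%SET.

Lemma one_separated_sep_set G :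
  (0 < n)%N -> one_separated G -> sep_set G.
Proof.
move=> n_gt0 [t [tG [_ t_sep]]].
have -> : G = [set x in take #|G| t]%SET.
  by apply/setP => x; rewrite inE -tG take_oversize // size_tuple.
suff take_sep q : (q <= #|G|)%N -> sep_set [set x in take q t]%SET.
  exact: take_sep.
elim: q => [_|q IHq q_lt].
  rewrite take0; rewrite (_ : finset _ = finset.set0); first exact: SepSet0.
  by apply/setP => x; rewrite !inE.
pose x := tnth t (Ordinal q_lt).
have -> : [set y in take q.+1 t]%SET = (x |: [set y in take q t])%SET.
  apply/setP => y; rewrite !inE (take_nth x) ?size_tuple //.
  by rewrite mem_rcons inE -[nth _ _ _](tnth_nth x t (Ordinal q_lt)).
(* The first element has no separating coordinate of its own; any coordinate serves, and [0 < n]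
   provides one. *)
have [q0|q_gt0] := posnP q.
  apply: (@SepSetU _ _ (Ordinal n_gt0)); first exact/IHq/ltnW.
  by rewrite q0 take0 => y; rewrite !inE.
have [i t_i] := t_sep (Ordinal q_lt) q_gt0.
apply: (@SepSetU _ _ i) => [|y]; first exact/IHq/ltnW.
rewrite inE => /(nthP x)[r]; rewrite size_takel ?size_tuple ?(ltnW q_lt) // => rq <-.
have rG := ltn_trans rq q_lt.
by rewrite nth_take // -[nth _ _ _](tnth_nth x t (Ordinal rG)) eq_sym t_i.
Qed.

End OneSeparated.

(** * Copies of a set with the same type *)

Section Transport.
Local Set Implicit Arguments.
Local Unset Strict Implicit.

Lemma size_destutter (T : eqType) (s : seq T) : (size (destutter s) <= size s)%N.
Proof.
elim: s => //= x s IHs; case: ifP => _ //=.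
exact: leqW.
Qed.

Variables (A : finType) (n : nat).
Implicit Types (G H : {set n.-tuple A}).

Lemma type_dim_le_n G : (type_dim G <= n)%N.
Proof.
apply: leq_trans (size_destutter _) _; rewrite size_filter.
by apply: leq_trans (count_size _ _) _; rewrite size_map size_enum_ord.
Qed.

Lemma eq_type_row G (i j : 'I_n) (x : n.-tuple A) :
  type_row G i = type_row G j -> x \in G -> tnth x i = tnth x j.
Proof.
move=> rowE xG; have /(congr1 (fun r => tnth r (enum_rank_in xG x))) := rowE.
by rewrite !tnth_mktuple enum_rankK_in.
Qed.

Lemma lift_rows G (s : seq (#|G|.-tuple A)) : {subset s <= type_rows G} ->
  exists c : seq 'I_n, map (type_row G) c = s.
Proof.
elim: s => [|r s IHs] s_sub; first by exists [::].
have [|c <-] := IHs; first by move=> r' r's; apply: s_sub; rewrite inE r's orbT.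
have := s_sub r (mem_head _ _).
rewrite mem_destutter mem_filter => /andP[_ /mapP[i _ ->]].
by exists (i :: c).
Qed.

Lemma mem_type_rows G x y i : x \in G -> y \in G -> tnth x i != tnth y i ->
  type_row G i \in type_rows G.
Proof.
move=> xG yG xy; rewrite mem_destutter mem_filter map_f ?mem_enum // andbT.
apply: contra xy => /constant_tupleP r_const.
have := r_const (enum_rank_in xG x) (enum_rank_in xG y).
by rewrite !tnth_mktuple !enum_rankK_in // => ->.
Qed.

(* [inl a] is the constant letter [a] and [inr c] copies the coordinate [c]. *)
Definition subst_coords (w : n.-tuple (A + 'I_n)) (x : n.-tuple A) : n.-tuple A :=
  map_tuple (fun l => match l with inl a => a | inr c => tnth x c end) w.

Lemma tuple_row_subst_coords G (w : n.-tuple (A + 'I_n)) (l : 'I_n) :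
  tuple_row [tuple subst_coords w (enum_val j) | j < #|G|] l =
  match tnth w l with inl a => [tuple a | j < #|G|] | inr c => type_row G c end.
Proof.
apply: eq_from_tnth => j; rewrite !tnth_mktuple tnth_map.
by case: (tnth w l) => [a|c]; rewrite tnth_mktuple.
Qed.

Section Rows.
Variables (G : {set n.-tuple A}) (w : n.-tuple (A + 'I_n)).
Let phi := subst_coords w.
Hypothesis G_gt1 : (1 < #|G|)%N.
Hypothesis rows_w : forall r, r \in type_rows G ->
  exists2 c, inr c \in w & type_row G c = r.

(** The row [i] is not constant on [G], so it survives in the type and [w] copies some coordinate
    with the same row. Hence every separation inside [G] is still visible after [phi]. *)
Lemma subst_coords_coord (i : 'I_n) (x y : n.-tuple A) :
  x \in G -> y \in G -> tnth x i != tnth y i ->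
  exists i', forall z, z \in G -> tnth (phi z) i' = tnth z i.
Proof.
move=> xG yG /(mem_type_rows xG yG)/rows_w[c /tnthP[l lE] cE].
by exists l => z zG; rewrite tnth_map -lE; apply: eq_type_row zG.
Qed.

Lemma subst_coords_inj : {in G &, injective phi}.
Proof.
move=> x y xG yG phiE; apply: eq_from_tnth => i.
have [//|xy] := eqVneq (tnth x i) (tnth y i).
have [i' i'E] := subst_coords_coord xG yG xy.
by rewrite -!i'E // phiE.
Qed.

Lemma subst_coords_sep_set H (i0 : 'I_n) :
  H \subset G -> sep_set H -> sep_set [set phi x | x in H]%SET.
Proof.
move=> HG H_sep; elim: H_sep HG => [|x {}H i _ IHH x_sep].
  by rewrite imset0 => _; apply: SepSet0.
rewrite imsetU1 finset.subUset finset.sub1set => /andP[xG HG].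
(* For empty [H] there is no second element to make a row nonconstant; the arbitrary coordinate [i0]
   is used instead. *)
have [->|[y yH]] := finset.set_0Vmem H.
  apply: (@SepSetU _ _ _ _ i0) => [|y]; last by rewrite imset0 finset.in_set0.
  by rewrite imset0; apply: SepSet0.
have [i' i'E] := subst_coords_coord (fintype.subsetP HG y yH) xG (x_sep y yH).
apply: (@SepSetU _ _ _ _ i') (IHH HG) _ => _ /imsetP[z zH ->].
by rewrite !i'E ?x_sep // (fintype.subsetP HG).
Qed.

Let t := [tuple phi (enum_val j) | j < #|G|].
Hypothesis t_rows : tuple_rows t = type_rows G.

Let mem_t : t =i [set phi x | x in G]%SET.
Proof.
move=> x; apply/tnthP/imsetP => [[j ->]|[y yG ->]].
  by exists (enum_val j); rewrite ?enum_valP // tnth_mktuple.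
by exists (enum_rank_in yG y); rewrite tnth_mktuple enum_rankK_in.
Qed.

Lemma type_of_subst_coords : type_of [set phi x | x in G]%SET = type_of G.
Proof.
have t_uniq : uniq t.
  rewrite map_inj_in_uniq ?enum_uniq // => j j' _ _ /subst_coords_inj jj'.
  by apply: enum_val_inj; apply: jj'; apply: enum_valP.
by rewrite (type_of_tuple t_uniq mem_t G_gt1) t_rows /type_of G_gt1.
Qed.

Lemma type_dim_subst_coords H :
  H \subset G -> (type_dim [set phi x | x in H]%SET <= type_dim G)%N.
Proof.
move=> HG; rewrite {2}/type_dim -t_rows; apply: type_dim_le => _ /imsetP[x xH ->].
by rewrite mem_t imset_f // (fintype.subsetP HG).
Qed.

End Rows.

(** The word [w z] copies one coordinate for each row of the type, in order, and inserts the letters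
    of [z] right after row [i], each [beta] being replaced by another copy of that row. The inserted
    constant rows are deleted and the extra copies merged, so the type is that of [G]. *)
Lemma transport G x0 i : (1 < #|G|)%N -> x0 \in G ->
    (forall y, y \in G -> y != x0 -> tnth y i != tnth x0 i) ->
  exists (V : comb_subspace A n)
      (phi : (cs_dim V).-tuple A -> n.-tuple A -> n.-tuple A),
    [/\ cs_dim V = (n - type_dim G)%N,
      forall z, canon_iso V z = phi z x0,
      forall z z' y, y \in G -> y != x0 ->
        ab_equivalent (tnth y i) (tnth x0 i) z z' -> phi z y = phi z' y,
      forall z, {in G &, injective (phi z)} /\
        type_of [set phi z x | x in G]%SET = type_of G &
      forall z H, H \subset G ->
        (type_dim [set phi z x | x in H]%SET <= type_dim G)%N /\
        (sep_set H -> sep_set [set phi z x | x in H]%SET)].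
Proof.
move=> G_gt1 x0G x0_sep; set beta := tnth x0 i; set d := (n - type_dim G)%N.
have row_i : type_row G i \in type_rows G.
  have [y] : exists y, y \in (G :\ x0)%SET.
    apply/set0Pn; apply: contraTneq G_gt1 => D0.
    by rewrite (cardsD1 x0) x0G D0 cards0.
  rewrite in_setD1 => /andP[yx0 yG].
  exact: mem_type_rows yG x0G (x0_sep y yG yx0).
have [c1 [c2 rowsE]] : exists c1 c2 : seq 'I_n,
    type_rows G = map (type_row G) (rcons c1 i) ++ map (type_row G) c2.
  case/path.splitP: row_i (@lift_rows G) => r1 r2 lift.
  have [|c1 c1E] := lift r1.
    by move=> r rr1; rewrite mem_cat mem_rcons inE rr1 orbT.
  have [|c2 c2E] := lift r2; first by move=> r rr2; rewrite mem_cat rr2 orbT.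
  by exists c1, c2; rewrite map_rcons c1E c2E.
(* One position per row of the type leaves exactly [d] positions free for the variables. *)
have sizeE : (size c1).+1 + (d + size c2) = n.
  have := type_dim_le_n G; rewrite addnCA /d.
  rewrite (_ : _ + size c2 = type_dim G); first exact: subnK.
  by rewrite /type_dim rowsE size_cat !size_map size_rcons.
(* At [x0] coordinate [i] reads [beta], so [mid] gives back [z]; at another [y] it replaces [beta]
   by [tnth y i]. *)
pose mid a : A + 'I_n := if a == beta then inr i else inl a.
pose w_seq (z : d.-tuple A) : seq (A + 'I_n) :=
  map inr (rcons c1 i) ++ map mid z ++ map inr c2.
have size_w z : size (w_seq z) == n.
  by rewrite !size_cat !size_map size_rcons size_tuple sizeE.
pose w z : n.-tuple (A + 'I_n) := Tuple (size_w z).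
pose v_seq : seq (A + 'I_d) := map (inl \o tnth x0) (rcons c1 i) ++
  map inr (enum 'I_d) ++ map (inl \o tnth x0) c2.
have size_v : size v_seq == n.
  rewrite !size_cat (size_map _ (rcons _ _)) (size_map _ (enum _)).
  by rewrite (size_map _ c2) size_rcons size_enum_ord sizeE.
have v_var : is_variable_word (Tuple size_v).
  (* Each variable occurs at a single position, after the [(size c1).+1] letters of the first block;
     the order condition follows. *)
  have var_pos (j : 'I_d) (p : 'I_n) :
      tnth (Tuple size_v) p = inr j -> p = (size c1).+1 + j :> nat.
    rewrite (tnth_nth (inl beta)) /= !nth_cat (size_map _ (rcons _ _)).
    rewrite (size_map _ (enum _)) size_rcons size_enum_ord.
    case: ltnP => [p_lt|p_ge].
      by rewrite (nth_map i) ?size_rcons.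
    case: ltnP => [p_lt|p_ge'].
      rewrite (nth_map (Ordinal p_lt)) ?size_enum_ord // => -[<-].
      by rewrite nth_enum_ord // subnKC.
    rewrite (nth_map i) // ltn_subLR // ltn_subLR //.
    by rewrite sizeE.
  split=> [j|j1 j2 p q j12 /var_pos-> /var_pos->]; last by rewrite ltn_add2l.
  by rewrite !mem_cat map_f ?mem_enum ?orbT.
exists (CombSubspace v_var), (fun z => subst_coords (w z)).
have rows_w z r : r \in type_rows G ->
    exists2 c, inr c \in w z & type_row G c = r.
  rewrite rowsE mem_cat => /orP[] /mapP[c cc ->]; exists c => //.
    by rewrite mem_cat (map_f _ cc).
  by rewrite !mem_cat (map_f _ cc) !orbT.
have w_rows z :
  tuple_rows [tuple subst_coords (w z) (enum_val j) | j < #|G|] = type_rows G.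
  rewrite /tuple_rows (eq_map (tuple_row_subst_coords _ _)).
  rewrite (map_comp (fun l => match l with inl a => [tuple a | j < #|G|]
    | inr c => type_row G c end) (tnth (w z))) map_tnth_enum.
  rewrite !map_cat !filter_cat -!map_comp.
  have filter_rows (c : seq 'I_n) :
      {subset map (type_row G) c <= type_rows G} ->
      [seq r : #|G|.-tuple A <- map (type_row G) c | ~~ constant r] =
      map (type_row G) c.
    move=> c_sub; apply/all_filterP/allP => r /c_sub.
    by rewrite mem_destutter mem_filter => /andP[].
  rewrite !filter_rows; last 2 first.
  - by move=> r rc; rewrite rowsE mem_cat rc orbT.
  - by move=> r rc; rewrite rowsE mem_cat rc.
  transitivity (destutter (type_rows G)); last exact: destutter_id.
  rewrite rowsE map_rcons !cat_rcons.
  (* After deletion of the constant rows, the middle block consists of one copy of row [i] for each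
     [beta] in [z]. *)
  rewrite -[RHS](destutter_nseq _ _ (count (pred1 beta) z)).
  congr (destutter (_ ++ _ :: _ ++ _)).
  move: row_i; rewrite mem_destutter mem_filter => /andP[row_i _].
  elim: (tval z) => //= a s IHs; rewrite /mid; case: eqP => _ /=.
    by rewrite row_i IHs.
  have /= -> : constant [tuple a | j < #|G|]; last exact: IHs.
  by apply/constant_tupleP => j j'; rewrite !tnth_mktuple.
split=> //.
- move=> z; apply: val_inj; rewrite [LHS]/=.
  rewrite (map_comp (fun l => match l with inl x => x | inr j => tnth z j end)
    (tnth (Tuple size_v))) map_tnth_enum /= !map_cat.
  congr (_ ++ _ ++ _); rewrite -[LHS]map_comp -[RHS]map_comp //.
  rewrite -[RHS](_ : tval z = _); first exact: map_tnth_enum.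
  by rewrite -[LHS]map_id; apply: eq_map => a /=; rewrite /mid; case: eqP.
- move=> z z' y yG yx0 zz'; apply: val_inj; rewrite /= !map_cat; congr (_ ++ _ ++ _).
  rewrite -!map_comp -(map_tnth_enum z) -(map_tnth_enum z') -!map_comp.
  apply: eq_map => j /=; rewrite /mid.
  (* A letter outside [tnth y i] and [beta] is common to [z] and [z']; either of these two letters
     becomes [tnth y i]. *)
  have [/andP[za zb]|] := boolP ((tnth z j != tnth y i) && (tnth z j != beta)).
    by rewrite ((zz' j _ za zb).1 erefl).
  have [/andP[za zb]|] :=
      boolP ((tnth z' j != tnth y i) && (tnth z' j != beta)).
    by rewrite ((zz' j _ za zb).2 erefl).
  rewrite !negb_and !negbK.
  by do 2![case/orP => /eqP->]; rewrite ?eqxx //; case: eqP.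
- move=> z; split; first exact: subst_coords_inj (rows_w z).
  exact: type_of_subst_coords (rows_w z) (w_rows z).
- move=> z H HG; split; first exact (type_dim_subst_coords (w_rows z) HG).
  exact (subst_coords_sep_set (rows_w z) i HG).
Qed.

End Transport.

Local Open Scope classical_set_scope.
Local Open Scope ring_scope.

(** * The density increment and probabilities of intersections *)

Section Increment.
Local Set Implicit Arguments.
Local Unset Strict Implicit.

(** Every variable occurs in the word, so its value can be read off at such a position. *)
Lemma canon_iso_inj (A : finType) (n : nat) (V : comb_subspace A n) :
  injective (canon_iso V).
Proof.
move=> z z' zz'; apply: eq_from_tnth => j.
have /tnthP[p pE] := (cs_wordP V).1 j.
by have := congr1 (fun t => tnth t p) zz'; rewrite !tnth_mktuple -pE.
Qed.

Context {disp : measure_display} {Omega : measurableType disp} {R : realType}.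
Variables (P : probability Omega R) (A : finType) (n : nat).
Variable D : n.-tuple A -> set Omega.

(** Alternative (ii) of the theorem, with its dimension bound and its two constants as
    parameters. *)
Definition density_increment (d : nat) (c1 c2 : R) : Prop :=
  exists (V : comb_subspace A n) (Gamma : {set A}) (beta : A)
      (S : n.-tuple A -> set Omega) (E : A -> n.-tuple A -> set Omega),
     [/\ (d <= cs_dim V)%N, Gamma != finset.set0, beta \notin Gamma,
         is_process (cs_set V) S &
     [/\ forall alpha, alpha \in Gamma ->
           is_process (cs_set V) (E alpha) /\ insensitive alpha beta V (E alpha),
         forall t, t \in cs_set V ->
           S t = \bigcap_(alpha in [set` Gamma]) E alpha t &
         forall t, t \in cs_set V ->
           (c1%:E <= P (S t))%E /\ (c2%:E <= cond_prob P (D t) (S t))%E]].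

(* The events are indexed by coordinates [z] in the subspace; those with the
   same label [alpha] are merged into [E alpha]. *)
Lemma density_increment_labelled (d : nat) (c1 c2 : R) (V : comb_subspace A n)
    (I : finType) (H : {set I}) (lab : I -> A) (beta : A)
    (F : I -> (cs_dim V).-tuple A -> set Omega)
    (S : (cs_dim V).-tuple A -> set Omega) :
  (d <= cs_dim V)%N -> H != finset.set0 ->
  (forall x, x \in H -> lab x != beta) ->
  (forall x z, x \in H -> measurable (F x z)) ->
  (forall x z z', x \in H -> ab_equivalent (lab x) beta z z' ->
     F x z = F x z') ->
  (forall z w, S z w <-> (forall x, x \in H -> F x z w)) ->
  (forall z, (c1%:E <= P (S z))%E /\
     (c2%:E <= cond_prob P (D (canon_iso V z)) (S z))%E) ->
  density_increment d c1 c2.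
Proof.
move=> dV H0 lab_beta F_meas F_ins SE S_bound.
(* Intersecting over fibers carries events from coordinates to points without choosing an inverse: a
   fiber is a singleton on the subspace and empty off it. *)
pose fiber t := [set z | canon_iso V z = t].
pose E alpha t := \bigcap_(z in fiber t)
  \bigcap_(x in [set` [set x in H | lab x == alpha]%SET]) F x z.
pose T t := \bigcap_(alpha in [set` (lab @: H)%SET]) E alpha t.
have fiberE z : fiber (canon_iso V z) = [set z].
  by apply/seteqP; split=> [z' /canon_iso_inj //|_ ->].
have E_meas alpha t : measurable (E alpha t).
  apply: fin_bigcap_measurable => [|z _]; first exact: finite_finset.
  apply: fin_bigcap_measurable => [|x /=]; first exact: finite_finset.
  by rewrite inE => /andP[xH _]; apply: F_meas.
exists V, (lab @: H)%SET, beta, T, E; split=> //.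
- by rewrite imset_eq0.
- by apply/imsetP => -[x xH betaE]; have := lab_beta x xH; rewrite betaE eqxx.
- move=> t _; apply: fin_bigcap_measurable; first exact: finite_finset.
  by move=> alpha _.
split=> // [alpha|t].
  move=> _; split=> [t _ //|z z' zz'].
  rewrite /E !fiberE !bigcap_set1; apply: eq_bigcapr => x /=.
  rewrite inE => /andP[xH /eqP labE]; apply: F_ins => //.
  by rewrite labE.
case/imsetP => z _ ->; rewrite (_ : T _ = S z) //.
rewrite /T /E fiberE; apply/seteqP; split=> w; rewrite SE => Tw.
  move=> x xH; have := Tw (lab x); rewrite bigcap_set1; apply => /=.
    exact: imset_f.
  by rewrite inE eqxx andbT.
move=> alpha _; rewrite bigcap_set1 => x /=; rewrite inE => /andP[xH _].
exact: Tw.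
Qed.

Lemma fine_probK (X : set Omega) : measurable X -> (fine (P X))%:E = P X.
Proof. by move=> X_meas; rewrite fineK // fin_num_measure. Qed.

Lemma ge_cond_prob (c : R) (X Y : set Omega) :
  measurable X -> measurable Y -> 0 < fine (P Y) ->
  c * fine (P Y) <= fine (P (X `&` Y)) -> (c%:E <= cond_prob P X Y)%E.
Proof.
move=> X_meas Y_meas Y_gt0 le; rewrite /cond_prob -(fine_probK Y_meas).
rewrite -fine_probK; last exact: measurableI.
by rewrite inver gt_eqF // -EFinM lee_fin ler_pdivlMr.
Qed.

Lemma fine_prob_setD (X Y : set Omega) : measurable X -> measurable Y ->
  fine (P (~` X `&` Y)) = fine (P Y) - fine (P (X `&` Y)).
Proof.
move=> X_meas Y_meas; apply: EFin_inj.
have XY_meas := measurableI _ _ X_meas Y_meas.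
rewrite EFinB !fine_probK //; last exact/measurableI/Y_meas/measurableC.
have Y_fin : (P Y < +oo)%E by rewrite -(fine_probK Y_meas) ltry.
by rewrite setIC -setDE (measureD Y_meas X_meas Y_fin) setIC.
Qed.

Lemma inter_event0 : inter_event D finset.set0 = setT.
Proof. by apply/seteqP; split=> // w _ t /=; rewrite finset.in_set0. Qed.

Lemma inter_eventU1 x G :
  inter_event D (x |: G)%SET = D x `&` inter_event D G.
Proof.
apply/seteqP; split=> w.
  by move=> Dw; split=> [|t tG]; apply: Dw => /=; rewrite in_setU1 ?eqxx ?tG ?orbT.
by move=> [Dx DG] t /=; rewrite in_setU1 => /predU1P[->|/DG].
Qed.

Lemma measurable_inter_event G :
  (forall t, measurable (D t)) -> measurable (inter_event D G).
Proof.
by move=> D_meas; apply: fin_bigcap_measurable => //; exact: finite_finset.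
Qed.

Lemma stationary_fine (eta : R) (G1 G2 : {set n.-tuple A}) :
  (forall t, measurable (D t)) -> stationary P eta D ->
  G1 != finset.set0 -> G2 != finset.set0 -> type_of G1 = type_of G2 ->
  `|fine (P (inter_event D G1)) - fine (P (inter_event D G2))| <= eta.
Proof.
move=> D_meas D_stat G1_neq0 G2_neq0 /(D_stat _ _ G1_neq0 G2_neq0).
rewrite -(fine_probK (measurable_inter_event G1 D_meas)).
by rewrite -(fine_probK (measurable_inter_event G2 D_meas)) -EFinB lee_fin.
Qed.

End Increment.

(** * Numerical estimates *)

Section Estimates.
Local Set Implicit Arguments.
Local Unset Strict Implicit.

(** Here [q] stands for the probability of the conditioning event, [p] for that of the intersection
    over [G], [r] for that over its copy. On one side [r > eps ^+ 2 * u + 3 * delta]; on the other,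
    expanding [(eps + theta) * (eps * u + delta)] gives at most [eps ^+ 2 * u + 3 * delta]. *)
Lemma excess_estimate (R : realFieldType) (eps u delta theta c q p r : R) :
  0 < eps <= 1 -> 0 < u <= 1 -> 0 < theta <= delta -> delta <= c / 2 ->
  8 * c <= eps * u ->
  `|q - eps * u| <= delta -> 4 * delta < p - eps ^+ 2 * u ->
  `|r - p| <= delta ->
  c <= q /\ (eps + theta) * q <= r.
Proof.
move=> /andP[eps_gt0 eps_le1] /andP[u_gt0 u_le1] /andP[theta_gt0 theta_le].
move=> delta_le c_le; rewrite !ler_norml => /andP[q_ge q_le] p_gt /andP[r_ge _].
split; first lra.
have eu_le1 : eps * u <= 1 by rewrite mulr_ile1 // ltW.
have th_le1 : theta <= 1 by lra.
have h1 : theta * (eps * u) <= delta * 1.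
  by apply: ler_pM => //; [exact: ltW|rewrite mulr_ge0 // ltW].
have h2 : (eps + theta) * delta <= 2 * delta.
  by rewrite ler_wpM2r //; lra.
have h3 : (eps + theta) * q <= (eps + theta) * (eps * u + delta).
  by rewrite ler_wpM2l //; lra.
apply: le_trans h3 _; rewrite mulrDr mulrDl; lra.
Qed.

(** Now [b - q] and [q' - r] are probabilities involving the complemented event. The second exceeds
    [eps * u * (1 - eps) + 2 * delta], while [(eps + theta) * (b - q)] is at most
    [eps * u * (1 - eps) + 3 / 2 * delta]. *)
Lemma deficit_estimate (R : realFieldType) (eps u delta theta c q b q' p r : R) :
  0 < eps <= 1 -> 0 < u <= 1 -> 0 < theta <= delta -> delta <= c / 2 ->
  8 * c <= eps * u -> 2 * c <= u * (1 - eps) ->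
  `|q - eps * u| <= delta -> `|b - u| <= delta / 4 ->
  `|q' - eps * u| <= delta -> 4 * delta < - (p - eps ^+ 2 * u) ->
  `|r - p| <= delta ->
  c <= b - q /\ (eps + theta) * (b - q) <= q' - r.
Proof.
move=> /andP[eps_gt0 eps_le1] /andP[u_gt0 u_le1] /andP[theta_gt0 theta_le].
move=> delta_le c_le c_le'; rewrite !ler_norml.
move=> /andP[q_ge q_le] /andP[b_ge b_le] /andP[q'_ge q'_le].
move=> p_lt /andP[_ r_le].
split; first lra.
have eu_le1 : eps * u <= 1 by rewrite mulr_ile1 // ltW.
have ue_le1 : u * (1 - eps) <= 1 - eps by rewrite ler_piMl //; lra.
have h1 : theta * (u * (1 - eps)) <= delta * (1 - eps).
  by apply: ler_pM => //; lra.
(* The hypotheses give [theta <= c / 2 <= 1 / 16], so [1 / 5] is a safe bound. *)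
have h2 : (eps + theta) * delta <= (eps + 1 / 5) * delta.
  by rewrite ler_wpM2r //; lra.
have h3 : (eps + theta) * (b - q) <= (eps + theta) * (u * (1 - eps) + 5 / 4 * delta).
  by rewrite ler_wpM2l //; lra.
have h4 : eps * delta <= 1 * delta by rewrite ler_wpM2r //; lra.
apply: le_trans h3 _; nra.
Qed.

End Estimates.

(** * From a deviating set to a density increment *)

Section Step.
Local Set Implicit Arguments.
Local Unset Strict Implicit.

(** The elements [x0] and [x1] are the last and second-to-last ones added. Coordinate [i] separates
    [x0] from everything before it, so [x1] can be omitted without losing separation. *)
Lemma sep_set_split2 (A : finType) (n : nat) (G : {set n.-tuple A}) :
  sep_set G -> (1 < #|G|)%N ->
  exists (x0 x1 : n.-tuple A) (H : {set n.-tuple A}) (i : 'I_n),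
    [/\ G = (x0 |: (x1 |: H))%SET, x0 \notin (x1 |: H)%SET, x1 \notin H,
      forall y, y \in (x1 |: H)%SET -> tnth y i != tnth x0 i &
      [/\ sep_set H, sep_set (x1 |: H)%SET & sep_set (x0 |: H)%SET]].
Proof.
case=> [|x0 G' i G'_sep]; first by rewrite cards0.
case: G'_sep => [_|x1 H j H_sep x1_sep x0_sep _].
  by rewrite finset.setU0 cards1.
exists x0, x1, H, i; split=> //.
- by apply/negP => /x0_sep; rewrite eqxx.
- by apply/negP => /x1_sep; rewrite eqxx.
split=> //; first exact: SepSetU H_sep x1_sep.
by apply: SepSetU H_sep _ => y yH; apply: x0_sep; rewrite in_setU1 yH orbT.
Qed.

(** In the application [u] is [eps ^+ (#|G| - 2)], [delta] is the deviation allowed for sets with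
    one element fewer, and [theta] is the gain in density. The two bounds are applied to the copies
    of subsets of [G], stationarity to the copy of [G] itself. *)
Lemma density_increment_step {disp : measure_display}
    {Omega : measurableType disp} {R : realType} (P : probability Omega R)
    (A : finType) (n m : nat) (D : n.-tuple A -> set Omega)
    (eps u delta theta eta c : R) (G : {set n.-tuple A}) :
  0 < eps <= 1 -> 0 < u <= 1 -> 0 < theta <= delta -> eta <= delta ->
  delta <= c / 2 -> 8 * c <= eps * u -> 2 * c <= u * (1 - eps) ->
  (forall t, measurable (D t)) -> stationary P eta D ->
  sep_set G -> (1 < #|G|)%N -> (type_dim G <= m)%N ->
  (forall H, sep_set H -> (type_dim H <= m)%N -> #|H| = #|G|.-1 ->
     `|fine (P (inter_event D H)) - eps * u| <= delta) ->
  (forall H, sep_set H -> (type_dim H <= m)%N -> #|H| = #|G|.-2 ->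
     `|fine (P (inter_event D H)) - u| <= delta / 4) ->
  4 * delta < `|fine (P (inter_event D G)) - eps ^+ 2 * u| ->
  density_increment P D (n - m) c (eps + theta).
Proof.
move=> eps01 u01 theta_delta eta_le delta_le c_le c_le' D_meas D_stat.
move=> G_sep G_gt1 G_dim bound1 bound2 G_far.
have [x0 [x1 [H [i [GE x0H x1H x0_sep [H_sep H1_sep H0_sep]]]]]] :=
  sep_set_split2 G_sep G_gt1.
have Hx (x : n.-tuple A) : x \notin H -> #|(x |: H)%SET| = #|H|.+1.
  by move=> xH; rewrite cardsU1 xH.
have Gcard : #|G| = #|H|.+2 by rewrite GE cardsU1 x0H Hx.
have x0G : x0 \in G by rewrite GE setU11.
have [|V [phi [dimV canonE phi_ins phi_G phi_sub]]] :=
    @transport _ _ G x0 i G_gt1 x0G.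
  by move=> y; rewrite GE in_setU1 => /predU1P[->|/x0_sep //]; rewrite eqxx.
have x0nH : x0 \notin H.
  by apply: contra x0H => x0H; rewrite in_setU1 x0H orbT.
have sub1 : (x1 |: H)%SET \subset G by rewrite GE subsetU1.
have sub0 : (x0 |: H)%SET \subset G by rewrite GE finset.setUS ?subsetU1.
have subH : H \subset G by apply: fintype.subset_trans sub1; apply: subsetU1.
have sub_phi z (K : {set n.-tuple A}) : K \subset G -> sep_set K ->
    [/\ sep_set [set phi z x | x in K]%SET,
      (type_dim [set phi z x | x in K]%SET <= m)%N &
      #|[set phi z x | x in K]%SET| = #|K|].
  move=> KG K_sep; have [dim sep] := phi_sub z K KG.
  split; [exact: sep|exact: leq_trans dim G_dim|].
  apply: card_in_imset => x y xK yK; apply: (phi_G z).1; exact: (fintype.subsetP KG).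
pose B z := inter_event D [set phi z x | x in H]%SET.
pose Z j z := D (phi z j).
have B_meas z : measurable (B z) by exact: measurable_inter_event.
have Z_meas j z : measurable (Z j z) by exact: D_meas.
have PB z : `|fine (P (B z)) - u| <= delta / 4.
  have [sep dim card] := sub_phi z H subH H_sep.
  by apply: bound2; rewrite // card Gcard.
have PZ1 z : `|fine (P (Z x1 z `&` B z)) - eps * u| <= delta.
  have [sep dim card] := sub_phi z _ sub1 H1_sep.
  rewrite /Z /B -inter_eventU1 -imsetU1; apply: bound1 => //.
  by rewrite card Gcard Hx.
have PZ0 z : `|fine (P (Z x0 z `&` B z)) - eps * u| <= delta.
  have [sep dim card] := sub_phi z _ sub0 H0_sep.
  rewrite /Z /B -inter_eventU1 -imsetU1; apply: bound1 => //.
  by rewrite card Gcard Hx.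
have PG z : `|fine (P (Z x0 z `&` (Z x1 z `&` B z))) -
              fine (P (inter_event D G))| <= delta.
  rewrite /Z /B -!inter_eventU1 -!imsetU1 -GE; apply: le_trans eta_le.
  apply: stationary_fine => //; last exact: (phi_G z).2.
    by apply/set0Pn; exists (phi z x0); apply: imset_f.
  by apply/set0Pn; exists x0.
have c_gt0 : 0 < c.
  case/andP: theta_delta => theta_gt0 theta_le.
  have := lt_le_trans theta_gt0 (le_trans theta_le delta_le).
  by rewrite pmulr_lgt0 // invr_gt0.
have dV : (n - m <= cs_dim V)%N by rewrite dimV leq_sub2l.
have lab x : x \in (x1 |: H)%SET -> tnth x i != tnth x0 i by exact: x0_sep.
have H1_neq0 : (x1 |: H)%SET != finset.set0.
  by apply/set0Pn; exists x1; apply: setU11.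
have H1_ins x z z' : x \in (x1 |: H)%SET ->
    ab_equivalent (tnth x i) (tnth x0 i) z z' -> Z x z = Z x z'.
  move=> xH zz'; rewrite /Z (phi_ins z z' x) //; first exact: (fintype.subsetP sub1).
  by apply: contraNneq x0H => <-.
move: G_far; rewrite ltr_normr => /orP[] far.
- apply: (density_increment_labelled dV H1_neq0 lab (F := Z)
    (S := fun z => Z x1 z `&` B z)) => // [z w|z].
    split=> [[Z1w Bw] x|Zw].
      by rewrite in_setU1 => /predU1P[->//|xH]; apply: Bw; apply: imset_f.
    split; first exact: Zw (setU11 _ _).
    by move=> _ /imsetP[x xH ->]; apply: Zw (setU1r _ xH).
  have S_meas : measurable (Z x1 z `&` B z) by apply: measurableI.
  have [S_ge S_le] := excess_estimate eps01 u01 theta_delta delta_le c_le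
    (PZ1 z) far (PG z).
  rewrite -(fine_probK P S_meas) lee_fin; split=> //.
  by rewrite canonE; apply: ge_cond_prob => //; apply: lt_le_trans S_ge.
(* Complementing an event preserves its insensitivity, so [F] has the same labels as [Z]. *)
- pose F x z := if x == x1 then ~` Z x z else Z x z.
  apply: (density_increment_labelled dV H1_neq0 lab (F := F)
    (S := fun z => ~` Z x1 z `&` B z)) => [x z _|x z z' xH zz'|z w|z].
  + by rewrite /F; case: ifP => // _; apply: measurableC.
  + by rewrite /F (H1_ins x z z').
  + split=> [[Zw Bw] x|Fw].
      rewrite in_setU1 /F; case: eqP => [-> //|_ /= xH].
      by apply: Bw; apply: imset_f.
    split; first by have := Fw x1 (setU11 _ _); rewrite /F eqxx.
    move=> _ /imsetP[x xH ->]; have := Fw x (setU1r _ xH).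
    by rewrite /F ifN //; apply: contraNneq x1H => <-.
  have Z1c_meas : measurable (~` Z x1 z) by apply: measurableC.
  have S_meas : measurable (~` Z x1 z `&` B z) by apply: measurableI.
  have [S_ge S_le] := deficit_estimate eps01 u01 theta_delta delta_le c_le c_le'
    (PZ1 z) (PB z) (PZ0 z) far (PG z).
  have PS := fine_prob_setD P (Z_meas x1 z) (B_meas z).
  rewrite -(fine_probK P S_meas) lee_fin PS; split=> //.
  rewrite canonE; apply: ge_cond_prob => //; rewrite PS.
    exact: lt_le_trans S_ge.
  have Z0B_meas : measurable (Z x0 z `&` B z) by apply: measurableI.
  (* Moving the complement to the front turns the probability into the difference [q' - r] of the
     estimate. *)
  by rewrite setICA (fine_prob_setD P (Z_meas x1 z) Z0B_meas) setICA.
Qed.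

End Step.

(** * Choice of the constants *)

(** The allowed deviation grows by a factor 4 with each element: it is [delta / 4], [delta] and
    [4 * delta] for sizes [l - 2], [l - 1] and [l]. *)
Lemma parameter_identities (R : realFieldType) (eps sigma : R) (kappa l : nat)
    (u := eps ^+ (l - 2)) (delta := sigma / 4 ^+ (kappa - l).+1) :
  (2 <= l <= kappa)%N ->
  [/\ sigma / 4 ^+ (kappa - l) = 4 * delta,
      sigma / 4 ^+ (kappa - (l - 1)) = delta,
      sigma / 4 ^+ (kappa - (l - 2)) = delta / 4,
      eps ^+ (l - 1) = eps * u & eps ^+ l = eps ^+ 2 * u].
Proof.
move=> l_bounds.
have pow_neq0 j : 4 ^+ j != 0 :> R by rewrite expf_neq0 // pnatr_eq0.
rewrite {}/u {}/delta.
have -> : (kappa - (l - 1) = (kappa - l).+1)%N by lia.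
have -> : (kappa - (l - 2) = (kappa - l).+2)%N by lia.
split=> //.
- by rewrite exprS; field.
- by rewrite !exprS; field.
- by rewrite -exprS; congr (_ ^+ _); lia.
- by rewrite -exprD; congr (_ ^+ _); lia.
Qed.

(** Everything is compared with [4 * kappa%:R * c = eps ^+ (kappa - 1)], which is at most any lower
    power of [eps]; the hypothesis on [sigma] reads [sigma <= 2 * c]. *)
Lemma parameter_bounds (R : realFieldType) (eps sigma : R) (kappa l : nat)
    (u := eps ^+ (l - 2)) (delta := sigma / 4 ^+ (kappa - l).+1)
    (c := eps ^+ (kappa - 1) / (4 * kappa%:R)) :
  (2 <= l <= kappa)%N -> 0 < eps -> 0 < sigma ->
  eps <= 1 - 1 / (2 * kappa%:R) ->
  sigma <= eps ^+ (kappa - 1) / (2 * kappa%:R) ->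
  [/\ 0 < eps <= 1, 0 < u <= 1, 0 < sigma / 4 ^+ (kappa - 1) <= delta,
      delta <= c / 2 & 8 * c <= eps * u /\ 2 * c <= u * (1 - eps)].
Proof.
move=> l_bounds eps0 sigma0 heps hsigma.
pose K : R := kappa%:R.
have K_ge2 : 2 <= K by rewrite (ler_nat R 2); lia.
have K_gt0 : 0 < K by apply: lt_le_trans K_ge2.
have eps_le1 : eps <= 1.
  by apply: le_trans heps _; rewrite gerBl divr_ge0 // mulr_ge0 // ltW.
have pow_gt0 j : 0 < 4 ^+ j :> R by apply: exprn_gt0.
have c_gt0 : 0 < c by rewrite divr_gt0 ?exprn_gt0 // mulr_gt0.
have cE : 4 * K * c = eps ^+ (kappa - 1).
  by rewrite /c mulrC divfK // gt_eqF // mulr_gt0.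
have sigma_le : sigma <= 2 * c.
  apply: le_trans hsigma _; rewrite -cE -/K.
  by have -> : 4 * K * c / (2 * K) = 2 * c by field; rewrite gt_eqF.
have pow_le j : (j <= kappa - 1)%N -> 4 * K * c <= eps ^+ j.
  by move=> j_le; rewrite cE; apply: ler_wiXn2l => //; apply: ltW.
have K_c : 2 * c <= K * c by rewrite ler_pM2r.
split.
- by rewrite eps0.
- by rewrite exprn_gt0 // exprn_ile1 // ltW.
- rewrite divr_gt0 //= ler_pM2l // lef_pV2 ?posrE //.
  by apply: ler_weXn2l; [rewrite ler1n|lia].
- have : delta <= sigma / 4.
    by rewrite ler_pM2l // lef_pV2 ?posrE // exprS ler_peMr // exprn_ege1 // ler1n.
  by lra.
split.
- have l_le : ((l - 2).+1 <= kappa - 1)%N by lia.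
  rewrite -exprS; apply: le_trans (pow_le _ l_le).
  by rewrite -mulrA; lra.
(* The two factors are bounded separately, by [u] and, using [heps], by [1 - eps]. *)
have -> : 2 * c = 4 * K * c * (1 / (2 * K)) by field; rewrite gt_eqF.
apply: ler_pM; last by rewrite lerBrDl -lerBrDr.
- by rewrite cE exprn_ge0 // ltW.
- by rewrite divr_ge0 // mulr_ge0 // ltW.
- by apply: pow_le; lia.
Qed.

(** * Induction on the size of the set *)

Theorem theorem7p2 (k kappa m : nat) (hk : (2 <= k)%N) (hkappa : (2 <= kappa)%N)
    (hm : (0 < m)%N) (hkm : (kappa <= k ^ m)%N)
    (R : realType) (eps sigma eta : R)
    (eps0 : 0 < eps) (sigma0 : 0 < sigma) (eta0 : 0 < eta)
    (heps : eps <= 1 - 1 / (2 * kappa%:R))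
    (hsigma : sigma <= eps ^+ (kappa - 1) / (2 * kappa%:R))
    (heta : eta <= sigma / 4 ^+ (kappa - 1))
    (A : finType) (hA : #|A| = k) (n : nat) (hn : (m < n)%N)
    (disp : measure_display) (Omega : measurableType disp)
    (P : probability Omega R) (D : n.-tuple A -> set Omega)
    (hD : is_process [set: n.-tuple A]%SET D)
    (hstat : stationary P eta D)
    (hprob : forall t : n.-tuple A, (`|P (D t) - eps%:E| <= eta%:E)%E) :
  (forall G : {set n.-tuple A}, G != finset.set0 -> one_separated G ->
     (#|G| <= kappa)%N -> (type_dim G <= m)%N ->
     (`|P (inter_event D G) - (eps ^+ #|G|)%:E| <= sigma%:E)%E)
  \/
  (exists (V : comb_subspace A n) (Gamma : {set A}) (beta : A)
      (S : n.-tuple A -> set Omega) (E : A -> n.-tuple A -> set Omega),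
     [/\ (n - m <= cs_dim V)%N, Gamma != finset.set0, beta \notin Gamma,
         is_process (cs_set V) S &
     [/\ forall alpha, alpha \in Gamma ->
           is_process (cs_set V) (E alpha) /\ insensitive alpha beta V (E alpha),
         forall t, t \in cs_set V ->
           S t = \bigcap_(alpha in [set` Gamma]) E alpha t &
         forall t, t \in cs_set V ->
           ((eps ^+ (kappa - 1) / (4 * kappa%:R))%:E <= P (S t))%E /\
           ((eps + sigma / 4 ^+ (kappa - 1))%:E <= cond_prob P (D t) (S t))%E]]).
Proof.
have D_meas t : measurable (D t) by apply: hD; exact: finset.in_setT.
have [|no_incr] := pselect (density_increment P D (n - m)
  (eps ^+ (kappa - 1) / (4 * kappa%:R)) (eps + sigma / 4 ^+ (kappa - 1))).
  by right.
left.
(* The tolerance depends on the size: it is exactly the bound on [eta] in [heta] for singletons and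
   rises to [sigma] at size [kappa]. *)
suff bound l (G : {set n.-tuple A}) :
    #|G| = l -> sep_set G -> G != finset.set0 -> (l <= kappa)%N ->
    (type_dim G <= m)%N ->
    `|fine (P (inter_event D G)) - eps ^+ l| <= sigma / 4 ^+ (kappa - l).
  move=> G G0 G_sep Gk Gm; rewrite -fine_probK; last exact: measurable_inter_event.
  rewrite -EFinB lee_fin; apply: le_trans (bound #|G| G erefl _ G0 Gk Gm) _.
    by apply: one_separated_sep_set => //; apply: leq_trans hn.
  rewrite ler_pdivrMr ?exprn_gt0 // ler_peMr ?(ltW sigma0) //.
  by rewrite exprn_ege1 // ler1n.
elim/ltn_ind: l G => l IHl G Gl G_sep G0 lk Gm.
have [l1|l_gt1] := leqP l 1.
  have /cards1P[t GE] : #|G| == 1%N by rewrite eqn_leq Gl l1 -Gl card_gt0.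
  have l_eq1 : l = 1%N by rewrite -Gl GE cards1.
  rewrite l_eq1 expr1; apply: le_trans heta.
  rewrite GE -[[set t]%SET]finset.setU0 inter_eventU1 inter_event0 setIT.
  by have := hprob t; rewrite -(fine_probK P (D_meas t)) -EFinB lee_fin.
have [//|far] := lerP; case: no_incr.
have l_bounds : (2 <= l <= kappa)%N by rewrite l_gt1.
have [sigma_l sigma_l1 sigma_l2 eps_l1 eps_l] :=
  parameter_identities R eps sigma kappa l l_bounds.
have [eps01 u01 theta_delta delta_c [c_eu c_u]] :=
  parameter_bounds R eps sigma kappa l l_bounds eps0 sigma0 heps hsigma.
have l_gt0 := ltnW l_gt1.
apply: (density_increment_step eps01 u01 theta_delta _ delta_c c_eu c_u D_meas
  hstat G_sep) => //.
- by apply: le_trans heta _; case/andP: theta_delta.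
- by rewrite Gl.
- move=> H H_sep Hm Hl; rewrite -eps_l1 -sigma_l1.
  have {}Hl : #|H| = (l - 1)%N by rewrite Hl Gl subn1.
  apply: IHl => //; first by rewrite subn1 ltn_predL.
    by rewrite -card_gt0 Hl subn_gt0.
  exact: leq_trans (leq_subr _ _) lk.
- move=> H H_sep Hm Hl; rewrite -sigma_l2.
  have {}Hl : #|H| = (l - 2)%N by rewrite Hl Gl subn2.
  (* The induction covers nonempty sets only; for [l = 2] the set [H] is empty, its intersection is
     the whole space and the deviation from [eps ^+ 0] is zero. *)
  have [H0|H0] := eqVneq H finset.set0.
    rewrite -Hl H0 cards0 inter_event0 probability_setT expr0 subrr normr0.
    by rewrite divr_ge0 ?exprn_ge0 // ltW.
  apply: IHl => //; first by rewrite -subn_gt0 subKn.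
  exact: leq_trans (leq_subr _ _) lk.
- by rewrite -sigma_l -eps_l.
Qed.
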